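(* Let $d\ge 1$ and $U_1,\dots,U_d\ge 1$ be integers, and let $\mathcal R^d=[1,U_1]\times\cdots\times[1,U_d]$. The integer linear program $\mathcal B(d)$ (given in the context) correctly models all non-empty grid boxes in $\mathcal R^d$. That is: for every non-empty grid box $R\subseteq\mathcal R^d$ there is a feasible assignment of the variables of $\mathcal B(d)$ with $\{\mathbf i\in\mathcal R^d : x_{\mathbf i}=1\}=R$; and conversely, for every feasible assignment of $\mathcal B(d)$, the set $\{\mathbf i\in\mathcal R^d : x_{\mathbf i}=1\}$ is a non-empty grid box in $\mathcal R^d$.
   Context: For integers $A\le B$, $[A,B]$ denotes the set of integers $\{A,A+1,\dots,B\}$. A grid box in $\mathcal R^d$ is a subset of the form $[s_1,t_1]\times\cdots\times[s_d,t_d]$ with $1\le s_k\le t_k\le U_k$ for all $1\le k\le d$. Let $\bar{\mathcal R}^d=[0,U_1+1]\times\cdots\times[0,U_d+1]$. For a grid point $\mathbf i$, $\mathbf i[k]$ denotes its $k$-th coordinate, and $\mathbf 1_k$ denotes the $k$-th $d$-dimensional unit vector. The integer linear program $\mathcal B(d)$ has the binary variables $x_{\mathbf i}\in\{0,1\}$ for all $\mathbf i\in\bar{\mathcal R}^d$, and $b_i^k\in\{0,1\}$, $e_i^k\in\{0,1\}$ for all $1\le k\le d$ and $1\le i\le U_k$, and the following constraints: (1) $x_{\mathbf i}=0$ for all $\mathbf i\in\bar{\mathcal R}^d\setminus\mathcal R^d$; (2) $\sum_{\mathbf i\in\bar{\mathcal R}^d}x_{\mathbf i}\ge 1$; (3)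 $\sum_{i\in[1,U_k]}b_i^k=1$ for all $1\le k\le d$; (4) $\sum_{i\in[1,U_k]}e_i^k=1$ for all $1\le k\le d$; (5) $x_{\mathbf i-\mathbf 1_k}+b^k_{\mathbf i[k]}\ge x_{\mathbf i}$ for all $\mathbf i\in\mathcal R^d$ and $1\le k\le d$; (6) $x_{\mathbf i}\le x_{\mathbf i+\mathbf 1_k}+e^k_{\mathbf i[k]}$ for all $\mathbf i\in\mathcal R^d$ and $1\le k\le d$. *)

(* Defs.v *)
From mathcomp Require Import all_boot.
Set Implicit Arguments.
Unset Strict Implicit.
Unset Printing Implicit Defensive.

(* Points of the extended grid [0, U_1 + 1] x ... x [0, U_d + 1]. *)
Notation ext_point U := {dffun forall k, 'I_(U k).+2}.

Section GridBoxes.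
Variables (d : nat) (U : 'I_d -> nat).

(* The grid [1, U_1] x ... x [1, U_d], as a subset of the extended grid. *)
Definition grid : {set ext_point U} :=
  [set i : ext_point U | [forall k, 1 <= i k <= U k]].

Definition grid_box (R : {set ext_point U}) : Prop :=
  exists s t : 'I_d -> nat,
    (forall k, [/\ 1 <= s k, s k <= t k & t k <= U k]) /\
    R = [set i : ext_point U | [forall k, s k <= i k <= t k]].

(* i - 1_k and i + 1_k. For i in the grid both stay in the extended grid, so
   neither the truncated subtraction nor the default value of inord matters. *)
Definition sub_unit (i : ext_point U) (k : 'I_d) : ext_point U :=
  [ffun l => inord (i l - (l == k))].
Definition add_unit (i : ext_point U) (k : 'I_d) : ext_point U :=
  [ffun l => inord (i l + (l == k))].

(* Binary variables are booleans, read in nat as 0 and 1. Only the values of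
   bvar k and evar k on [1, U_k] represent variables of the program: no
   constraint refers to any other value. *)
Record assignment : Type := Assignment {
  xvar : ext_point U -> bool;
  bvar : 'I_d -> nat -> bool;
  evar : 'I_d -> nat -> bool
}.

Record feasible (v : assignment) : Prop := Feasible {
  x_outside : forall i : ext_point U, i \notin grid -> xvar v i = 0 :> nat;
  x_nonempty : \sum_(i : ext_point U) xvar v i >= 1;
  b_unique : forall k, \sum_(1 <= j < (U k).+1) bvar v k j = 1;
  e_unique : forall k, \sum_(1 <= j < (U k).+1) evar v k j = 1;
  x_begin : forall (i : ext_point U) k, i \in grid ->
    xvar v (sub_unit i k) + bvar v k (i k) >= xvar v i;
  x_end : forall (i : ext_point U) k, i \in grid ->
    xvar v i <= xvar v (add_unit i k) + evar v k (i k)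
}.

Definition selected (v : assignment) : {set ext_point U} :=
  [set i in grid | xvar v i == 1 :> nat].

End GridBoxes.

(* Main.v *)
Require Import Defs.
From mathcomp Require Import all_boot zify.

(* In a feasible assignment let s_k and t_k be the only indices with
   b^k = 1 and e^k = 1. From a selected point i with i[k] <> s_k, constraint (5)
   makes i - 1_k selected as well; as nothing is selected outside the grid, this
   descent must stop, and can only stop at i[k] = s_k. Hence s_k <= i[k], and the
   whole segment below i down to s_k is selected; symmetrically with (6) up to
   t_k. So every selected point lies in the box [s, t], and its coordinates can
   be replaced one at a time by those of any other point of the box. *)

(** The sum is the length of the list of indices in the range where [a] holds. Length 1 makes this
    list [[:: m]], and membership in it gives both the range of [m] and its uniqueness. *)
Lemma sum_bool_eq1P (a : nat -> bool) (n : nat) :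
  \sum_(1 <= j < n.+1) a j = 1 ->
  exists m, 1 <= m <= n /\ forall j, 1 <= j <= n -> a j = (j == m).
Proof.
have -> : \sum_(1 <= j < n.+1) a j = size [seq j <- index_iota 1 n.+1 | a j].
  by rewrite size_filter -sum1_count [RHS]big_mkcond; apply: eq_bigr => j _; case: (a j).
case def_r: [seq j <- _ | a j] => [|m []] // _; exists m.
have mem_r j : (a j && (1 <= j <= n)) = (j == m).
  by rewrite -(ltnS j) -mem_index_iota -mem_filter def_r inE.
split; first by move: (mem_r m); rewrite eqxx => /andP[].
by move=> j j_in; rewrite -mem_r j_in andbT.
Qed.

Lemma sum_bool_pred1 (m n : nat) :
  1 <= m <= n -> \sum_(1 <= j < n.+1) (j == m) = 1.
Proof.
move=> m_in; rewrite (bigD1_seq m) ?iota_uniq ?mem_index_iota //= eqxx.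
by rewrite big1 // => j /negPf->.
Qed.

Section Grid.
Context {d : nat} {U : 'I_d -> nat}.
Implicit Types (i j : ext_point U) (k l : 'I_d).

Lemma gridP i : reflect (forall k, 1 <= i k <= U k) (i \in grid U).
Proof. by rewrite inE; apply: forallP. Qed.

Lemma sub_unitE i k l : sub_unit i k l = i l - (l == k) :> nat.
Proof. by rewrite ffunE inordK //; have := ltn_ord (i l); lia. Qed.

(** Unlike subtraction, adding 1 can leave the extended grid: at [i k = (U k).+1] the [inord] would
    fall back to its default value. The hypothesis excludes this. *)
Lemma add_unitE i k l :
  i k <= U k -> add_unit i k l = i l + (l == k) :> nat.
Proof.
move=> i_le; rewrite ffunE inordK //.
by case: eqP => [->|_]; [lia | rewrite addn0; apply: ltn_ord].
Qed.

Lemma ext_point_eq i j k :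
  (forall l, l != k -> i l = j l :> nat) -> i k = j k :> nat -> i = j.
Proof.
move=> off_k at_k; apply/ffunP => l; apply: val_inj.
by have [->|/off_k] := eqVneq l k.
Qed.

Section Feasible.
Variables (v : assignment U) (v_feas : feasible v).

Lemma xvar_grid i : xvar v i -> i \in grid U.
Proof. by move=> xi; apply: contraT => /(x_outside v_feas); rewrite xi. Qed.

Lemma selectedE i : (i \in selected v) = xvar v i.
Proof.
rewrite inE eqb1; apply/andP/idP => [[]//|xi].
by split=> //; apply: xvar_grid.
Qed.

Variables (s t : 'I_d -> nat).
Hypothesis b_s : forall k (m : nat), 1 <= m <= U k -> bvar v k m = (m == s k).
Hypothesis e_t : forall k (m : nat), 1 <= m <= U k -> evar v k m = (m == t k).

Lemma xvar_sub_unit i k : xvar v i -> i k != s k :> nat -> xvar v (sub_unit i k).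
Proof.
move=> xi /negPf ne_s; have gi := xvar_grid _ xi.
have := x_begin v_feas k gi.
by rewrite xi b_s ?ne_s ?addn0; [case: (xvar v _) | apply/gridP].
Qed.

Lemma xvar_add_unit i k : xvar v i -> i k != t k :> nat -> xvar v (add_unit i k).
Proof.
move=> xi /negPf ne_t; have gi := xvar_grid _ xi.
have := x_end v_feas k gi.
by rewrite xi e_t ?ne_t ?addn0; [case: (xvar v _) | apply/gridP].
Qed.

Lemma begin_le i k : xvar v i -> s k <= i k.
Proof.
have [n] := ubnP (i k); elim: n i => // n IHn i lt_n xi.
have [-> //|ne_s] := eqVneq (i k : nat) (s k).
have /gridP/(_ k) gi := xvar_grid _ xi.
by have := IHn _ _ (xvar_sub_unit _ _ xi ne_s); rewrite sub_unitE eqxx; lia.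
Qed.

Lemma le_end i k : xvar v i -> i k <= t k.
Proof.
have [n] := ubnP (U k - i k); elim: n i => // n IHn i lt_n xi.
have [-> //|ne_t] := eqVneq (i k : nat) (t k).
have /gridP/(_ k) gi := xvar_grid _ xi.
have xi1 := xvar_add_unit _ _ xi ne_t.
(* That [add_unit i k] is still in the grid forces [i k < U k], so the measure [U k - i k] strictly
   decreases despite truncated subtraction. *)
have /gridP/(_ k) := xvar_grid _ xi1.
by have := IHn _ _ xi1; rewrite add_unitE ?eqxx; lia.
Qed.

Lemma xvar_below i j k : xvar v i -> (forall l, l != k -> j l = i l :> nat) ->
  s k <= j k <= i k -> xvar v j.
Proof.
have [n] := ubnP (i k); elim: n i => // n IHn i lt_n xi off_k j_in.
have [eq_k|ne_k] := eqVneq (j k : nat) (i k); first by rewrite (ext_point_eq _ _ _ off_k).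
(* Here [s k <= j k < i k], so the descent from [i] towards [j] has not yet reached [s k] and may go
   one step further. *)
have ne_s : i k != s k :> nat by lia.
apply: IHn (xvar_sub_unit _ _ xi ne_s) _ _; rewrite ?sub_unitE ?eqxx; try lia.
by move=> l ne_l; rewrite sub_unitE (negPf ne_l) subn0 off_k.
Qed.

Lemma xvar_above i j k : xvar v i -> (forall l, l != k -> j l = i l :> nat) ->
  i k <= j k <= t k -> xvar v j.
Proof.
have [n] := ubnP (t k - i k); elim: n i => // n IHn i lt_n xi off_k j_in.
have [eq_k|ne_k] := eqVneq (j k : nat) (i k); first by rewrite (ext_point_eq _ _ _ off_k).
have ne_t : i k != t k :> nat by lia.
have /gridP/(_ k)/andP[_ i_le] := xvar_grid _ xi.
apply: IHn (xvar_add_unit _ _ xi ne_t) _ _; rewrite ?add_unitE ?eqxx //; try lia.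
by move=> l ne_l; rewrite add_unitE // (negPf ne_l) addn0 off_k.
Qed.

Lemma xvar_box i j : xvar v i -> (forall k, s k <= j k <= t k) -> xvar v j.
Proof.
move=> xi j_in.
(* [p n] takes its first [n] coordinates from [j] and the others from [i]. It leads from [p 0 = i]
   to [p d = j], changing only coordinate [n] between [p n] and [p n.+1]. *)
pose p n : ext_point U := [ffun l : 'I_d => if l < n then j l else i l].
have xp n : n <= d -> xvar v (p n).
  elim: n => [_|n IHn lt_n].
    by suff -> : p 0 = i by []; apply/ffunP => l; rewrite ffunE.
  pose k := Ordinal lt_n; have xpn := IHn (ltnW lt_n).
  have off_k l : l != k -> p n.+1 l = p n l :> nat.
    move=> ne_l; rewrite !ffunE ltnS leq_eqVlt.
    by have /negPf-> : l != n :> nat by [].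
  have pk : p n.+1 k = j k by rewrite ffunE ltnSn.
  (* The changed coordinate moves either down, staying above [s k], or up, staying below [t k]. *)
  have [le_k|/ltnW le_k] := leqP (p n.+1 k) (p n k).
    apply: xvar_below xpn off_k _; rewrite le_k pk andbT.
    by case/andP: (j_in k).
  apply: xvar_above xpn off_k _; rewrite le_k pk /=.
  by case/andP: (j_in k).
suff <- : p d = j by apply: xp.
by apply/ffunP => l; rewrite ffunE ltn_ord.
Qed.

End Feasible.

Lemma feasible_grid_box (v : assignment U) :
  feasible v -> selected v != set0 /\ grid_box (selected v).
Proof.
move=> v_feas.
have [s s_P] := fin_all_exists (fun k => sum_bool_eq1P _ _ (b_unique v_feas k)).
have [t t_P] := fin_all_exists (fun k => sum_bool_eq1P _ _ (e_unique v_feas k)).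
have b_s k := (s_P k).2; have e_t k := (t_P k).2.
have [i xi] : exists i, xvar v i.
  apply/existsP; apply: contraT => /existsPn x0.
  by have := x_nonempty v_feas; rewrite big1 // => i _; rewrite (negPf (x0 i)).
have in_box j k : xvar v j -> s k <= j k <= t k.
  by move=> xj; rewrite (begin_le _ v_feas s) ?(le_end _ v_feas t).
split; first by apply/set0Pn; exists i; rewrite selectedE.
exists s, t; split=> [k|].
  (* The inequality [s k <= t k] comes from the selected point [i], whose coordinate [i k] lies
     between them. *)
  by have := in_box i k xi; have := (s_P k).1; have := (t_P k).1; split; lia.
apply/setP => j; rewrite selectedE // inE.
apply/idP/forallP => [xj k|j_in]; first exact: in_box.
exact: (xvar_box v v_feas s t b_s e_t i).
Qed.

Lemma grid_box_feasible (R : {set ext_point U}) :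
  R != set0 -> grid_box R ->
  exists v : assignment U, feasible v /\ selected v = R.
Proof.
move=> R_neq0 [s [t [st def_R]]].
have inR i : reflect (forall k, s k <= i k <= t k) (i \in R).
  by rewrite def_R inE; apply: forallP.
have R_grid i : i \in R -> i \in grid U.
  by move/inR=> i_in; apply/gridP => k; have := i_in k; have [] := st k; lia.
(* The variables [x] are the indicator of [R]; [b] and [e] mark its lower and upper corners. *)
pose v := Assignment (fun i : ext_point U => i \in R)
  (fun k m => m == s k) (fun k m => m == t k).
have v_feas : feasible v.
  split=> [i|||| i k gi | i k gi] /=.
  - by move=> ngi; apply/eqP; rewrite eqb0; apply: contra ngi; apply: R_grid.
  - case/set0Pn: R_neq0 => i iR.
    by rewrite (bigD1 i) //= iR.
  - by move=> k; apply: sum_bool_pred1; have [] := st k; lia.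
  - by move=> k; apply: sum_bool_pred1; have [] := st k; lia.
  (* On the lower face [i k = s k] the variable [b] supplies the required 1; elsewhere [s k < i k],
     so [sub_unit i k] remains in the box. *)
  - case iR: (i \in R) => //; have [_|ne_s] := eqVneq (i k : nat) (s k); first by rewrite addn1.
    suff -> : sub_unit i k \in R by [].
    apply/inR => l; rewrite sub_unitE; have /inR/(_ l) := iR.
    by case: eqP => [->|_]; lia.
  - case iR: (i \in R) => //; have [_|ne_t] := eqVneq (i k : nat) (t k); first by rewrite addn1.
    suff -> : add_unit i k \in R by [].
    have /gridP/(_ k)/andP[_ i_le] := gi.
    apply/inR => l; rewrite add_unitE //; have /inR/(_ l) := iR.
    by case: eqP => [->|_]; lia.
by exists v; split=> //; apply/setP => i; rewrite selectedE.
Qed.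

End Grid.

Theorem lemma2 (d : nat) (U : 'I_d -> nat)
    (d_ge1 : 1 <= d) (U_ge1 : forall k, 1 <= U k) :
  (forall R : {set ext_point U}, R != set0 -> grid_box R ->
     exists v : assignment U, feasible v /\ selected v = R) /\
  (forall v : assignment U, feasible v ->
     selected v != set0 /\ grid_box (selected v)).
Proof.
by split; [apply: grid_box_feasible | apply: feasible_grid_box].
Qed.
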